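(* Let $\mathcal{B}_1$ be the arrangement consisting of $n_1$ lines passing through a point $a_1\in\mathbb{P}^2$, and let $\mathcal{B}_2$ be the arrangement consisting of $n_2$ lines passing through a point $a_2\in\mathbb{P}^2\setminus\mathcal{B}_1$ (that is, $a_2$ lies on no line of $\mathcal{B}_1$), with $3\leq n_1\leq n_2$, and let $\mathcal{A}'=\mathcal{B}_1\cup\mathcal{B}_2$. If we add a generic line to the line arrangement $\mathcal{A}'$ (i.e. a line meeting $\mathcal{A}'$ in exactly $\deg\mathcal{A}'=n_1+n_2$ points), then we get a line arrangement of type $2B$ with exponents $$(n_1+1,\ n_2+1,\ n_1+n_2-1,\ n_1+n_2-1).$$
   Context: A line arrangement is a finite set of distinct lines in $\mathbb{P}^2=\mathbb{P}^2_{\mathbb{C}}$, identified with the reduced curve given by their union. Let $S=\mathbb{C}[x,y,z]$ with its standard grading. For a reduced curve $C:f=0$ of degree $d$ in $\mathbb{P}^2$, let $$D_0(f)=\{(a,b,c)\in S^3 : af_x+bf_y+cf_z=0\}$$ be the graded $S$-module of Jacobian syzygies, where a homogeneous element $(a,b,c)$ has degree $k$ if $a,b,c$ are homogeneous of degree $k$. Let $d_1\leq d_2\leq\dots\leq d_m$ be the degrees of the elements of a minimal system of homogeneous generators of $D_0(f)$; $(d_1,\dots,d_m)$ are the exponents of $C$. The type of $C$ is $t(C)=d_1+d_2+1-d$. A curve of type $2$ has $m=3$ or $m=4$; it is said to be of type $2A$ if $m=3$ and of type $2B$ if $m=4$.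
   Formalization: The formal theorem also assumes that a_1 lies on no line of B_2; if the line a_1a_2 belongs to B_2, the resulting arrangement has a syzygy of degree n_2 that contradicts the stated exponents, so the claim is false there. *)

(* Defs.v *)
From HB Require Import structures.
From mathcomp Require Import all_boot all_order all_algebra.
From mathcomp Require Import finmap mpoly complex reals.

Set Implicit Arguments.
Unset Strict Implicit.
Unset Printing Implicit Defensive.

Import GRing.Theory.
Local Open Scope ring_scope.

(* One-dimensional subspaces of C^3. Used both for the points of P^2 and, via
   the dual plane, for its lines: the line [l0 : l1 : l2] is the zero set of
   l0 x + l1 y + l2 z. *)
Definition proj_plane (R : realType) : Type :=
  {U : {vspace 'rV[R[i]]_3} | \dim U == 1%N}.

HB.instance Definition _ (R : realType) := Choice.on (proj_plane R).

Notation point R := (proj_plane R).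
Notation line R := (proj_plane R).

(* [vpick] returns a nonzero vector; none of the notions below depends on the
   choice, which only rescales a defining equation by a nonzero constant. *)
Definition hcoord (R : realType) (p : proj_plane R) : 'rV[R[i]]_3 :=
  vpick (val p).

Definition on_line (R : realType) (p : point R) (L : line R) : bool :=
  \sum_(i < 3) hcoord L 0 i * hcoord p 0 i == 0.

Definition line_eq (R : realType) (L : line R) : {mpoly R[i][3]} :=
  \sum_(i < 3) hcoord L 0 i *: 'X_i.

Definition arrangement_eq (R : realType) (A : {fset line R}) : {mpoly R[i][3]} :=
  \prod_(L <- A) line_eq L.

Definition generic_line (R : realType) (A : {fset line R}) (H : line R) : Prop :=
  exists P : {fset point R},
    #|` P| = #|` A| /\
    forall p : point R, (p \in P) = on_line p H && has (on_line p) A.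

Section Exponents.
Variable K : fieldType.
Implicit Type f : {mpoly K[3]}.

Definition jacobian_syzygy f (s : 'rV[{mpoly K[3]}]_3) : Prop :=
  \sum_(i < 3) s 0 i * f^`M(i) = 0.

Definition homog_triple (k : nat) (s : 'rV[{mpoly K[3]}]_3) : Prop :=
  forall i : 'I_3, s 0 i \is k.-homog.

Definition generates_syzygies f m (g : 'I_m -> 'rV[{mpoly K[3]}]_3)
    (J : {set 'I_m}) : Prop :=
  forall s, jacobian_syzygy f s <->
    exists c : 'I_m -> {mpoly K[3]}, s = \sum_(i in J) c i *: g i.

Definition minimal_generators f m (g : 'I_m -> 'rV[{mpoly K[3]}]_3) : Prop :=
  generates_syzygies f g [set: 'I_m] /\
  forall J : {set 'I_m}, generates_syzygies f g J -> J = [set: 'I_m].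

(* By graded Nakayama the sorted sequence [ds] does not depend on [g]. *)
Definition has_exponents f (ds : seq nat) : Prop :=
  sorted leq ds /\
  exists g : 'I_(size ds) -> 'rV[{mpoly K[3]}]_3,
    minimal_generators f g /\
    forall i : 'I_(size ds), homog_triple (nth 0%N ds i) (g i).

(* d1 + d2 + 1 - d, where the degree d of f is [(msize f).-1]. *)
Definition type_of_exponents f (ds : seq nat) : int :=
  (nth 0%N ds 0)%:Z + (nth 0%N ds 1)%:Z + 1 - ((msize f).-1)%:Z.

Definition is_type2B f : Prop :=
  exists ds : seq nat,
    [/\ has_exponents f ds, type_of_exponents f ds = 2 & size ds = 4%N].

End Exponents.

(* Main.v *)
From HB Require Import structures.
Require Import Defs.
From mathcomp Require Import all_boot all_order all_algebra.
From mathcomp Require Import finmap mpoly complex reals.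
From mathcomp Require Import ring zify.

Set Implicit Arguments.
Unset Strict Implicit.
Unset Printing Implicit Defensive.

Import GRing.Theory Num.Theory.
Local Open Scope ring_scope.

(** Choose linear forms x, y, z such that x and z vanish at the first centre,
    y and z vanish at the second, and the added line is h = x + y. The lines
    through the first centre are then a x + c z with a <> 0, those through the
    second b y + c z with b <> 0. Write F1 and F2 for the two products, of
    degrees n1 and n2, so that f = h F1 F2, F1 = x P + z q1 and F2 = y Q + z q2
    with P = A x^(n1-1), Q = B y^(n2-1) and A, B nonzero constants.

    A syzygy s is a vector field with s(f) = 0. Because the lines are pairwise
    distinct primes, such a field maps every line l of f to a multiple of l.
    The Wronskian z s(l) - l s(z) of a line l = a x + c z is a times
    z s(x) - x s(z); hence all the lines through the first centre divide the
    latter, and so F1 does. This gives polynomials u, v with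
      z s(x) - x s(z) = F1 u   and   z s(y) - y s(z) = F2 v.
    Conversely a field that respects all the lines becomes a syzygy after
    subtraction of a multiple of the Euler field, which does not change u and v
    (this is where the characteristic intervenes). In this way the module of
    syzygies is identified ([syzygy_uv], [uv_syzygy], [related_inj]) with the
    module of pairs (u, v) such that
      z | P u - Q v   and   h | F1 u + F2 v.

    These two conditions are solved by a fact on coprime elements modulo a prime
    ([syzygy_mod_prime]): modulo h the pair is a multiple of (F2, -F1), because
    no line through the first centre meets h on a line through the second;
    modulo z it is a multiple of (Q, P). The pair (F2, -F1 + h P) satisfies both
    conditions: it is (F2, -F1) modulo h and y (Q, P) modulo z. Subtracting a
    multiple of it leaves h (u', v') with z | P u' - Q v', so the module is
    generated ([uv_span]) by
      (z h, 0),   (0, z h),   h (Q, P),   (F2, -F1 + h P),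
    which correspond to syzygies of degrees n1 + 1, n2 + 1, n1 + n2 - 1 and
    n1 + n2 - 1. In every relation between these four pairs all coefficients
    vanish at the origin ([uv_minimal]), so none of the four is superfluous.

    The geometric input is that the generic line meets the arrangement in as
    many points as there are lines: it is then not a line of the arrangement,
    and no two lines of the arrangement meet on it
    ([generic_not_concurrent]). *)

(** * Divisibility and primes *)

Section Divisibility.
Variable S : comNzRingType.
Implicit Types a b p q r : S.

Definition rdvd p q := exists r, q = r * p.
Definition in_ideal2 p q r := exists a b, r = a * p + b * q.

Lemma rdvdD p a b : rdvd p a -> rdvd p b -> rdvd p (a + b).
Proof. by move=> [r ->] [s ->]; exists (r + s); rewrite mulrDl. Qed.

Lemma rdvd_mull p a b : rdvd p b -> rdvd p (a * b).
Proof. by move=> [r ->]; exists (a * r); rewrite mulrA. Qed.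

Lemma rdvd_mulr p a b : rdvd p a -> rdvd p (a * b).
Proof. by rewrite mulrC; exact: rdvd_mull. Qed.

Lemma rdvdxx p : rdvd p p.
Proof. by exists 1; rewrite mul1r. Qed.

Lemma rdvdN p a : rdvd p a -> rdvd p (- a).
Proof. by rewrite -mulN1r; exact: rdvd_mull. Qed.

Lemma rdvdB p a b : rdvd p a -> rdvd p b -> rdvd p (a - b).
Proof. by move=> pa pb; apply: rdvdD => //; exact: rdvdN. Qed.

Definition prime_elt p := forall a b, rdvd p (a * b) -> rdvd p a \/ rdvd p b.

Definition prime_ideal2 p q :=
  forall a b, in_ideal2 p q (a * b) -> in_ideal2 p q a \/ in_ideal2 p q b.

End Divisibility.

Section Primes.
Variable S : idomainType.
Implicit Types a b p q u v F c : S.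

Lemma prime_elt_cancel p a b :
  prime_elt p -> ~ rdvd p a -> rdvd p (a * b) -> rdvd p b.
Proof. by move=> pr_p npa /pr_p[]. Qed.

Lemma prime_eltX p x n : prime_elt p -> ~ rdvd p x -> ~ rdvd p 1 ->
  ~ rdvd p (x ^+ n).
Proof.
move=> pr_p npx np1; elim: n => [|n IH]; first by rewrite expr0.
by rewrite exprS => /pr_p[].
Qed.

(** Distinct primes divide independently: once one of them is split off, the
    others still divide the cofactor. *)
Lemma prod_rdvd (I : eqType) (s : seq I) (l : I -> S) a :
  uniq s -> (forall i, i \in s -> prime_elt (l i)) ->
  (forall i j, i \in s -> j \in s -> i != j -> ~ rdvd (l i) (l j)) ->
  (forall i, i \in s -> rdvd (l i) a) -> rdvd (\prod_(i <- s) l i) a.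
Proof.
elim: s a => [|i s IH] a /=; first by exists a; rewrite big_nil mulr1.
case/andP=> is_ us pr ne dv; rewrite big_cons.
have [b ab] := dv i (mem_head _ _).
have [|||c bc] := IH b us.
- by move=> j js; apply: pr; rewrite inE js orbT.
- by move=> j k js ks; apply: ne; rewrite inE ?js ?ks orbT.
- move=> j js; have jis : j \in i :: s by rewrite inE js orbT.
  have ji : j != i by apply: contraNneq is_ => <-.
  have := dv j jis; rewrite ab => /(pr j jis)[//|].
  by move/(ne j i jis (mem_head _ _) ji).
by exists c; rewrite ab bc; ring.
Qed.

(** Syzygies of two coprime elements modulo a prime are Koszul. The second
    element is a product of primes l modulo p, none of which divides F modulo p;
    the relation shows that l divides u modulo p, so that l can be cancelled
    from the whole relation. No factoriality modulo p is involved, and the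
    factors may be repeated. *)
Lemma syzygy_mod_prime p F c (s : seq S) u v :
  prime_elt p -> c \is a GRing.unit ->
  (forall l, l \in s -> [/\ ~ rdvd p l, prime_ideal2 p l & ~ in_ideal2 p l F]) ->
  rdvd p (F * u + c * \prod_(l <- s) l * v) ->
  exists t, rdvd p (u - t * (c * \prod_(l <- s) l)) /\ rdvd p (v + t * F).
Proof.
move=> pr_p cU; elim: s u => [|l s IH] u hs.
  rewrite big_nil mulr1 => dv; exists (c^-1 * u); split.
    by exists 0; rewrite mul0r mulrAC mulVr // mul1r subrr.
  have -> : v + c^-1 * u * F = c^-1 * (F * u + c * v).
    by rewrite mulrDr [c^-1 * (c * v)]mulrA mulVr // mul1r; ring.
  exact: rdvd_mull.
rewrite big_cons; set G := \prod_(_ <- s) _.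
have [npl pr_pl nF] := hs l (mem_head _ _) => -[r Er].
have /pr_pl[/nF//|[a [b Eu]]] : in_ideal2 p l (F * u).
  exists r, (- (c * G * v)).
  have -> : F * u = F * u + c * (l * G) * v - c * (l * G) * v by ring.
  by rewrite Er; ring.
have [||t [tu tv]] := IH b.
- by move=> k ks; apply: hs; rewrite inE ks orbT.
- have : rdvd p (l * (F * b + c * G * v)).
    exists (r - F * a).
    have -> : (r - F * a) * p = r * p - F * a * p by ring.
    by rewrite -Er Eu; ring.
  exact: prime_elt_cancel.
exists t; split=> //.
have -> : u - t * (c * (l * G)) = a * p + l * (b - t * (c * G)).
  by rewrite Eu; ring.
by apply: rdvdD; [exists a | exact: rdvd_mull].
Qed.

End Primes.

(** * Linear forms and the ideals that they generate *)

Section LinearForms.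
Variables (K : fieldType) (n : nat).
Implicit Types (l : 'rV[K]_n) (p q : {mpoly K[n]}).

Definition lin l : {mpoly K[n]} := \sum_(i < n) l 0 i *: 'X_i.

Lemma lin_is_linear : linear lin.
Proof.
move=> a l m; rewrite /lin scaler_sumr -big_split; apply: eq_bigr => i _ /=.
by rewrite !mxE scalerDl scalerA.
Qed.

HB.instance Definition _ :=
  GRing.isLinear.Build K 'rV[K]_n {mpoly K[n]} _ lin lin_is_linear.

Lemma lin_homog l : lin l \is 1.-homog.
Proof.
apply: rpred_sum => i _; apply: dhomogZ.
by rewrite dhomogX; apply/eqP; exact: mdeg1.
Qed.

Lemma lin_inj : injective lin.
Proof.
move=> l m E; apply/rowP => i.
have coefE k : (lin k)@_U_(i) = k 0 i.
  rewrite /lin raddf_sum (bigD1 i) //= mcoeffZ mcoeffX eqxx mulr1.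
  rewrite big1 ?addr0 // => j ji.
  rewrite mcoeffZ mcoeffX; case: eqP => [E'|_]; last by rewrite mulr0.
  by move/mnmP/(_ j): E'; rewrite !mnm1E eqxx [i == j]eq_sym (negPf ji).
by rewrite -!coefE E.
Qed.

Lemma lin_eq0 l : (lin l == 0) = (l == 0).
Proof. by rewrite -(inj_eq lin_inj) linear0. Qed.

Lemma lin_meval0 l : (lin l).@[fun=> 0] = 0.
Proof.
rewrite /lin raddf_sum big1 // => i _.
by rewrite /= mevalZ mevalXU mulr0.
Qed.

Definition lin_ideal r (N : 'M[K]_(r, n)) p :=
  exists c : 'I_r -> {mpoly K[n]}, p = \sum_i c i * lin (row i N).

Section Subst.
Variables (r : nat) (N : 'M[K]_(r, n)).

Lemma lin_idealD p q : lin_ideal N p -> lin_ideal N q -> lin_ideal N (p + q).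
Proof.
move=> [c ->] [d ->]; exists (fun i => c i + d i).
by rewrite -big_split; apply: eq_bigr => i _; rewrite mulrDl.
Qed.

Lemma lin_ideal_mull p q : lin_ideal N q -> lin_ideal N (p * q).
Proof.
move=> [c ->]; exists (fun i => p * c i).
by rewrite mulr_sumr; apply: eq_bigr => i _; rewrite mulrA.
Qed.

Lemma lin_ideal0 : lin_ideal N 0.
Proof. by exists (fun=> 0); rewrite big1 // => i _; rewrite mul0r. Qed.

Lemma lin_ideal_sub l : (l <= N)%MS -> lin_ideal N (lin l).
Proof.
case/submxP => D ->; exists (fun i => (D 0 i)%:MP).
rewrite mulmx_sum_row linear_sum; apply: eq_bigr => i _.
by rewrite linearZ mul_mpolyC.
Qed.

(* [C] projects the linear forms along the row space of [N], and [phi] is the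
   substitution that extends it: its kernel is the ideal of [N], which is
   therefore prime. *)
Let C := 1%:M - pinvmx N *m N.
Let phi p := p \mPo [tuple lin (row i C) | i < n].

Let phi_lin l : phi (lin l) = lin (l *m C).
Proof.
rewrite /phi /lin raddf_sum -/(lin _) mulmx_sum_row linear_sum.
apply: eq_bigr => i _.
by rewrite /= comp_mpolyZ comp_mpolyXU -tnth_nth tnth_mktuple linearZ.
Qed.

Let phiM : {morph phi : p q / p * q}.
Proof. by move=> p q; rewrite /phi rmorphM. Qed.

Let phi_cong p : lin_ideal N (p - phi p).
Proof.
have congM p1 q1 p2 q2 : lin_ideal N (p1 - q1) -> lin_ideal N (p2 - q2) ->
    lin_ideal N (p1 * p2 - q1 * q2).
  move=> h1 h2; have -> : p1 * p2 - q1 * q2 = p2 * (p1 - q1) + q1 * (p2 - q2).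
    by ring.
  by apply: lin_idealD; apply: lin_ideal_mull.
have phiXU i : lin_ideal N ('X_i - phi 'X_i).
  have -> : 'X_i = lin (delta_mx 0 i) :> {mpoly K[n]}.
    rewrite /lin (bigD1 i) //= mxE !eqxx scale1r big1 ?addr0 // => j ji.
    by rewrite mxE (negPf ji) andbF scale0r.
  rewrite phi_lin -linearB; apply: lin_ideal_sub.
  by rewrite mulmxBr mulmx1 opprB addrC subrK mulmxA submxMl.
have phiX m : lin_ideal N ('X_[m] - phi 'X_[m]).
  rewrite mpolyXE_id /phi rmorph_prod.
  apply: (big_ind2 (fun a b => lin_ideal N (a - b))) => //=.
    by rewrite subrr; exact: lin_ideal0.
  move=> i _; rewrite rmorphXn; elim: (m i) => [|k IH].
    by rewrite !expr0 subrr; exact: lin_ideal0.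
  by rewrite !exprS; exact: congM.
elim/mpolyind: p => [|c m p _ _ IH].
  by rewrite /phi raddf0 subrr; exact: lin_ideal0.
have -> : c *: 'X_[m] + p - phi (c *: 'X_[m] + p) =
    c%:MP * ('X_[m] - phi 'X_[m]) + (p - phi p).
  by rewrite /phi raddfD /= comp_mpolyZ mulrBr !mul_mpolyC opprD; ring.
by apply: lin_idealD => //; exact: lin_ideal_mull.
Qed.

Let NC0 : N *m C = 0.
Proof. by rewrite /C mulmxBr mulmx1 mulmxA mulmxKpV ?subrr. Qed.

Let lin_idealE p : lin_ideal N p <-> phi p = 0.
Proof.
split=> [[c ->]|p0]; last by have := phi_cong p; rewrite p0 subr0.
rewrite /phi raddf_sum big1 // => i _; apply: etrans (phiM _ _) _; rewrite phi_lin.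
by rewrite -row_mul NC0 row0 linear0 mulr0.
Qed.

Lemma lin_ideal_prime p q :
  lin_ideal N (p * q) -> lin_ideal N p \/ lin_ideal N q.
Proof.
move/lin_idealE/eqP; rewrite phiM mulf_eq0.
by case/orP => /eqP E; [left | right]; apply/lin_idealE.
Qed.

Lemma lin_ideal_lin l : lin_ideal N (lin l) <-> (l <= N)%MS.
Proof.
split=> [|/lin_ideal_sub//].
move/lin_idealE/eqP; rewrite phi_lin lin_eq0 mulmxBr mulmx1 subr_eq0.
by move/eqP->; rewrite mulmxA submxMl.
Qed.

Lemma lin_ideal_neq1 : ~ lin_ideal N 1.
Proof. by move/lin_idealE/eqP; rewrite /phi rmorph1 oner_eq0. Qed.

End Subst.

Lemma rdvd_lin l p : rdvd (lin l) p <-> lin_ideal l p.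
Proof.
split=> [[r ->]|[c ->]].
  by exists (fun=> r); rewrite big_ord_recl big_ord0 addr0 row_id.
by exists (c 0); rewrite big_ord_recl big_ord0 addr0 row_id.
Qed.

Lemma in_ideal2_lin l m p :
  in_ideal2 (lin l) (lin m) p <-> lin_ideal (col_mx l m) p.
Proof.
have E c : \sum_(i < 1 + 1) c i * lin (row i (col_mx l m)) =
    c (lshift 1 0) * lin l + c (rshift 1 0) * lin m.
  by rewrite big_split_ord !big_ord1 rowKu rowKd !row_id.
split=> [[a [b ->]]|[c ->]]; last by exists (c (lshift 1 0)), (c (rshift 1 0)).
by exists (fun i => if split i is inl _ then a else b); rewrite E (unsplitK (inl 0)) (unsplitK (inr 0)).
Qed.

Lemma lin_prime l : prime_elt (lin l).
Proof. by move=> p q /rdvd_lin/lin_ideal_prime[] /rdvd_lin; [left|right]. Qed.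

Lemma lin2_prime l m : prime_ideal2 (lin l) (lin m).
Proof.
by move=> p q /in_ideal2_lin/lin_ideal_prime[] /in_ideal2_lin; [left|right].
Qed.

Lemma lin_cancel l p q :
  ~ rdvd (lin l) p -> rdvd (lin l) (p * q) -> rdvd (lin l) q.
Proof. exact/prime_elt_cancel/lin_prime. Qed.

Lemma lin_rdvd1 l : ~ rdvd (lin l) 1.
Proof. by move/rdvd_lin; exact: lin_ideal_neq1. Qed.

Lemma lin_rdvd l m : rdvd (lin l) (lin m) <-> (m <= l)%MS.
Proof.
exact: iff_trans (rdvd_lin _ _) (lin_ideal_lin _ _).
Qed.

Lemma lin_in_ideal2 l m k :
  in_ideal2 (lin l) (lin m) (lin k) <-> (k <= col_mx l m)%MS.
Proof.
exact: iff_trans (in_ideal2_lin _ _ _) (lin_ideal_lin _ _).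
Qed.

End LinearForms.

(** * Homogeneous polynomials *)

Section Homogeneity.
Variables (K : fieldType) (n : nat).
Implicit Types p q : {mpoly K[n]}.

Lemma homogM d e k p q : p \is d.-homog -> q \is e.-homog -> k = (d + e)%N ->
  p * q \is k.-homog.
Proof. by move=> hp hq ->; exact: dhomogM. Qed.

(** The homogeneous components of p q are the products of p with those of q,
    and p may be cancelled from the ones that vanish. *)
Lemma homog_cofactor d k p q : p != 0 -> p \is d.-homog ->
  p * q \is (d + k).-homog -> q \is k.-homog.
Proof.
move=> p0 hp hpq; have [b Eq] : exists b, q = \sum_(j < b) pihomog mdeg j q.
  by exists (mmeasure mdeg q); exact: pihomog_partitionE.
suff hj (j : 'I_b) : pihomog mdeg j q \is k.-homog by rewrite Eq; apply: rpred_sum.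
have [<-|jk] := eqVneq (j : nat) k; first exact: pihomogP.
suff -> : pihomog mdeg j q = 0 by exact: dhomog0.
apply/eqP; rewrite -(mulrI_eq0 _ (mulfI p0)); apply/eqP.
have := pihomog_ne0 (mf := mdeg) (b := (d + j)%N) _ hpq.
rewrite eqn_add2l eq_sym => /(_ jk) <-.
rewrite {2}Eq [in RHS]mulr_sumr linear_sum (bigD1 j) //= big1 => [|i ij].
  rewrite addr0 [in RHS]pihomog_dE //; by apply: dhomogM => //; exact: pihomogP.
apply: (pihomog_ne0 (d := (d + i)%N)); last by apply: dhomogM => //; exact: pihomogP.
by rewrite eqn_add2l.
Qed.

Lemma mderiv_homog d i p : p \is d.+1.-homog -> p^`M(i) \is d.-homog.
Proof.
move=> /dhomogP hp; apply/dhomogP => m; rewrite mcoeff_msupp mcoeff_deriv => m0.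
have mi : (m + U_(i))%MM \in msupp p.
  by rewrite mcoeff_msupp; apply: contraNneq m0 => ->; rewrite mul0rn.
by apply: succn_inj; rewrite -(hp _ mi) /= mdegD mdeg1 addn1.
Qed.

Lemma homog_meval0 k p : (0 < k)%N -> p \is k.-homog -> p.@[fun=> 0] = 0.
Proof.
move=> k0 /dhomogP hp; rewrite mevalE big_seq big1 // => m /hp dm.
have [i mi] : exists i, m i != 0%N.
  apply/existsP; rewrite -negb_forall; apply: contraL k0 => /forallP m0.
  rewrite -leqNgt leqn0 -(dm : mdeg m = k) mdegE sum_nat_eq0.
  by apply/forallP => i; rewrite (eqP (m0 i)).
by rewrite (bigD1 i) //= expr0n (negPf mi) mul0r mulr0.
Qed.

Lemma prod_lin_homog (s : seq 'rV[K]_n) :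
  \prod_(l <- s) lin l \is (size s).-homog.
Proof.
elim: s => [|l s IH]; first by rewrite big_nil dhomog1.
by rewrite big_cons; apply: (homogM (lin_homog l) IH).
Qed.

End Homogeneity.

(** * Polynomial vector fields *)

Section VectorFields.
Variable K : fieldType.
Implicit Types (s t : 'rV[{mpoly K[3]}]_3) (p q : {mpoly K[3]}) (l : 'rV[K]_3).

(** Triples are read as derivations, so that Jacobian syzygies are the vector
    fields that kill f. *)
Definition theta s p := \sum_(i < 3) s 0 i * p^`M(i).

Lemma thetaM s p q : theta s (p * q) = theta s p * q + p * theta s q.
Proof.
rewrite /theta mulr_suml mulr_sumr -big_split; apply: eq_bigr => i _ /=.
by rewrite mderivM; ring.
Qed.

Lemma theta1 s : theta s 1 = 0.
Proof. by rewrite /theta big1 // => i _; rewrite mderivC mulr0. Qed.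

Lemma thetaDl s t p : theta (s + t) p = theta s p + theta t p.
Proof.
by rewrite /theta -big_split; apply: eq_bigr => i _ /=; rewrite mxE mulrDl.
Qed.

Lemma thetaZl c s p : theta (c *: s) p = c * theta s p.
Proof.
by rewrite /theta mulr_sumr; apply: eq_bigr => i _ /=; rewrite mxE mulrA.
Qed.

Lemma theta0l p : theta 0 p = 0.
Proof. by rewrite /theta big1 // => i _; rewrite mxE mul0r. Qed.

Lemma theta_suml (I : Type) (r : seq I) (P : pred I) (c : I -> {mpoly K[3]})
    (g : I -> 'rV[{mpoly K[3]}]_3) p :
  theta (\sum_(i <- r | P i) c i *: g i) p =
  \sum_(i <- r | P i) c i * theta (g i) p.
Proof.
elim/big_rec2: _ => [|i a b _ <-]; first exact: theta0l.
by rewrite thetaDl thetaZl.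
Qed.

Lemma theta_lin s l : theta s (lin l) = \sum_(i < 3) s 0 i * (l 0 i)%:MP.
Proof.
apply: eq_bigr => i _; congr (_ * _).
rewrite /lin raddf_sum (bigD1 i) //= mderivZ mderivX mnmE eqxx scale1r.
rewrite big1 ?addr0 => [|j ji].
  have -> : (U_(i) - U_(i))%MM = 0%MM :> 'X_{1..3}.
    by apply/mnmP => k; rewrite mnmBE subnn mnm0E.
  by rewrite mpolyX0 -mul_mpolyC mulr1.
by rewrite mderivZ mderivX mnmE (negPf ji) scale0r scaler0.
Qed.

Lemma theta_linD s l l' : theta s (lin (l + l')) = theta s (lin l) + theta s (lin l').
Proof.
rewrite !theta_lin -big_split; apply: eq_bigr => i _ /=.
by rewrite mxE mpolyCD mulrDr.
Qed.

Lemma theta_linZ s a l : theta s (lin (a *: l)) = a%:MP * theta s (lin l).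
Proof.
rewrite !theta_lin mulr_sumr; apply: eq_bigr => i _ /=.
by rewrite mxE mpolyCM mulrCA.
Qed.

Lemma theta_prod_rdvd s (r : seq 'rV[K]_3) :
  (forall l, l \in r -> rdvd (lin l) (theta s (lin l))) ->
  rdvd (\prod_(l <- r) lin l) (theta s (\prod_(l <- r) lin l)).
Proof.
elim: r => [|l r IH] hr; first by exists 0; rewrite big_nil theta1 mul0r.
have [|b Eb] := IH; first by move=> k kr; apply: hr; rewrite inE kr orbT.
have [a Ea] := hr l (mem_head _ _).
by exists (a + b); rewrite big_cons thetaM Ea Eb; ring.
Qed.

Lemma rdvd_theta s p q : prime_elt p -> ~ rdvd p q ->
  rdvd (p * q) (theta s (p * q)) -> rdvd p (theta s p).
Proof.
move=> pr_p npq [a]; rewrite thetaM => E.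
apply: (prime_elt_cancel pr_p npq); exists (a * q - theta s q).
have -> : q * theta s p = theta s p * q + p * theta s q - p * theta s q by ring.
by rewrite E; ring.
Qed.

Definition euler : 'rV[{mpoly K[3]}]_3 := \row_i 'X_i.

Lemma euler_lin l : theta euler (lin l) = lin l.
Proof. by rewrite theta_lin; apply: eq_bigr => i _; rewrite mxE mulrC mul_mpolyC. Qed.

Lemma euler_prod_lin (r : seq 'rV[K]_3) :
  theta euler (\prod_(l <- r) lin l) = (size r)%:R * \prod_(l <- r) lin l.
Proof.
elim: r => [|l r IH]; first by rewrite big_nil theta1 mul0r.
rewrite big_cons thetaM IH euler_lin /= -[in RHS]natr1; ring.
Qed.

(** A vector field may be prescribed by its values on any basis of the linear
    forms, the rows of M; the degrees are the same in the new coordinates. *)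
Lemma theta_coordinates (M : 'M[K]_3) (v : 'I_3 -> {mpoly K[3]}) : M \in unitmx ->
  exists s, (forall i, theta s (lin (row i M)) = v i) /\
    forall k, (forall i, v i \is k.-homog) -> homog_triple k s.
Proof.
move=> Mu; exists (\row_j \sum_i (invmx M j i)%:MP * v i); split=> [i|k hv j].
  rewrite theta_lin.
  transitivity (\sum_k (M *m invmx M) i k *: v k); last first.
    rewrite mulmxV // (bigD1 i) //= mxE eqxx scale1r big1 ?addr0 // => j ji.
    by rewrite mxE eq_sym (negPf ji) scale0r.
  transitivity (\sum_(j < 3) \sum_k ((M i j * invmx M j k) *: v k)).
    apply: eq_bigr => j _; rewrite !mxE mulr_suml; apply: eq_bigr => k _.
    by rewrite -mul_mpolyC mpolyCM; ring.
  by rewrite exchange_big; apply: eq_bigr => k _; rewrite mxE scaler_suml.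
by rewrite mxE; apply: rpred_sum => i _; rewrite mul_mpolyC; apply: dhomogZ.
Qed.

Lemma theta_coordinates_inj (M : 'M[K]_3) s : M \in unitmx ->
  (forall i, theta s (lin (row i M)) = 0) -> s = 0.
Proof.
move=> Mu s0; apply/rowP => j; rewrite mxE.
transitivity (\sum_i (invmx M j i)%:MP * theta s (lin (row i M))); last first.
  by rewrite big1 // => i _; rewrite s0 mulr0.
transitivity (\sum_k (invmx M *m M) j k *: s 0 k).
  rewrite mulVmx // (bigD1 j) //= mxE eqxx scale1r big1 ?addr0 // => k kj.
  by rewrite mxE eq_sym (negPf kj) scale0r.
transitivity (\sum_i \sum_k ((invmx M j i * M i k) *: s 0 k)).
  by rewrite exchange_big; apply: eq_bigr => k _; rewrite mxE scaler_suml.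
apply: eq_bigr => i _; rewrite theta_lin mulr_sumr; apply: eq_bigr => k _.
by rewrite !mxE -mul_mpolyC mpolyCM; ring.
Qed.

End VectorFields.

(** * Incidence of points and linear forms *)

Section Incidence.
Variable K : fieldType.
Implicit Types l m k p : 'rV[K]_3.

Definition dot l p := \sum_(i < 3) l 0 i * p 0 i.

Lemma dotDl l m p : dot (l + m) p = dot l p + dot m p.
Proof.
by rewrite /dot -big_split; apply: eq_bigr => i _; rewrite mxE mulrDl.
Qed.

Lemma dotZl a l p : dot (a *: l) p = a * dot l p.
Proof.
by rewrite /dot mulr_sumr; apply: eq_bigr => i _; rewrite mxE mulrA.
Qed.

Lemma dot0l p : dot 0 p = 0.
Proof. by rewrite -(scale0r (0 : 'rV[K]_3)) dotZl mul0r. Qed.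

Lemma dot_neq0 l p : dot l p != 0 -> l != 0.
Proof. by apply: contra_neq => ->; exact: dot0l. Qed.

Lemma lin_rdvdP l m : rdvd (lin l) (lin m) -> exists a, m = a *: l.
Proof. by move/lin_rdvd/sub_rVP. Qed.

Lemma lin_in_ideal2P l m k :
  in_ideal2 (lin l) (lin m) (lin k) -> exists a b, k = a *: l + b *: m.
Proof.
move/lin_in_ideal2; rewrite -addsmxE => /sub_addsmxP[[u v] ->] /=.
by exists (u 0 0), (v 0 0); rewrite {1}[u]mx11_scalar {1}[v]mx11_scalar !mul_scalar_mx.
Qed.

Lemma dot_nrdvd p l m : dot l p = 0 -> dot m p != 0 -> ~ rdvd (lin l) (lin m).
Proof. by move=> lp /eqP mp /lin_rdvdP[a E]; apply: mp; rewrite E dotZl lp mulr0. Qed.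

Lemma dot_nrdvd_sym p l m :
  dot l p != 0 -> dot m p = 0 -> m != 0 -> ~ rdvd (lin l) (lin m).
Proof.
move=> lp mp /eqP m0 /lin_rdvdP[a E]; apply: m0.
move/eqP: mp; rewrite E dotZl mulf_eq0 (negPf lp) orbF => /eqP->.
by rewrite scale0r.
Qed.

Lemma dot_nin_ideal2 p l m k : dot l p = 0 -> dot m p = 0 -> dot k p != 0 ->
  ~ in_ideal2 (lin l) (lin m) (lin k).
Proof.
move=> lp mp /eqP kp /lin_in_ideal2P[a [b E]]; apply: kp.
by rewrite E dotDl !dotZl lp mp !mulr0 addr0.
Qed.

(** The coordinates adapted to two centres p1, p2 and a line h through neither.
    Both x and z are found in the pencil of lines through p1 that is spanned by
    l and l'; [x] is scaled to agree with h at p2, so that y = h - x vanishes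
    there. *)
Lemma exists_pencil_coordinates p1 p2 h l l' :
  dot l p1 = 0 -> dot l' p1 = 0 -> dot l p2 != 0 -> ~ (l' <= l)%MS ->
  dot h p1 != 0 -> dot h p2 != 0 ->
  exists x y z, [/\ h = x + y, dot x p1 = 0, dot x p2 != 0, dot y p1 != 0 &
    dot y p2 = 0] /\ [/\ dot z p1 = 0, dot z p2 = 0 & z != 0].
Proof.
move=> lp1 l'p1 lp2 l'l hp1 hp2.
pose x := (dot h p2 / dot l p2) *: l; pose y := h + (-1) *: x.
pose z := dot l' p2 *: l + (- dot l p2) *: l'.
have xp1 : dot x p1 = 0 by rewrite dotZl lp1 mulr0.
have xp2 : dot x p2 = dot h p2 by rewrite dotZl divfK.
exists x, y, z; split; split; rewrite ?xp2 //.
- by rewrite /y addrCA scaleN1r subrr addr0.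
- by rewrite dotDl dotZl xp1 mulr0 addr0.
- by rewrite dotDl dotZl xp2 mulN1r subrr.
- by rewrite dotDl !dotZl lp1 l'p1 !mulr0 addr0.
- by rewrite dotDl !dotZl mulNr mulrC subrr.
apply/eqP; rewrite /z scaleNr => /eqP; rewrite subr_eq0 => /eqP E.
apply: l'l; apply/sub_rVP; exists ((dot l p2)^-1 * dot l' p2).
by rewrite -scalerA E scalerA mulVf // scale1r.
Qed.

End Incidence.

(** * Products of linear forms *)

Section Products.
Variable K : fieldType.
Implicit Types (l w z : 'rV[K]_3) (r : seq 'rV[K]_3).

Lemma polyC_unit (a : K) : a != 0 -> (a%:MP : {mpoly K[3]}) \is a GRing.unit.
Proof.
by move=> a0; apply/unitrP; exists (a^-1)%:MP; rewrite -!mpolyCM mulVf ?mulfV // mpolyC1.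
Qed.

Lemma rdvd_prod l r (P : pred 'rV[K]_3) :
  rdvd (lin l) (\prod_(k <- r | P k) lin k) ->
  exists2 k, (k \in r) && P k & rdvd (lin l) (lin k).
Proof.
elim: r => [|k r IH]; first by rewrite big_nil => /lin_rdvd1.
have tl : rdvd (lin l) (\prod_(k <- r | P k) lin k) ->
    exists2 j, (j \in k :: r) && P j & rdvd (lin l) (lin j).
  by move=> /IH[j /andP[jr Pj] dj]; exists j => //; rewrite inE jr orbT.
rewrite big_cons; case: ifP => // Pk /lin_prime[dk|//].
by exists k; rewrite // mem_head.
Qed.

Lemma in_ideal2_prod l m r :
  in_ideal2 (lin l) (lin m) (\prod_(k <- r) lin k) ->
  exists2 k, k \in r & in_ideal2 (lin l) (lin m) (lin k).
Proof.
elim: r => [|k r IH]; first by rewrite big_nil => /in_ideal2_lin/lin_ideal_neq1.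
rewrite big_cons => /lin2_prime[dk|/IH[j jr dj]].
  by exists k; rewrite // mem_head.
by exists j; rewrite // inE jr orbT.
Qed.

(** By the Leibniz rule, modulo l only the term s(l) times the product of the
    other lines remains, and l does not divide that product. *)
Lemma theta_line s r : uniq r ->
  {in r &, forall k l, k != l -> ~ rdvd (lin l) (lin k)} ->
  theta s (\prod_(l <- r) lin l) = 0 ->
  forall l, l \in r -> rdvd (lin l) (theta s (lin l)).
Proof.
move=> ur ndv E l lr; move: E; rewrite (bigD1_seq l) //= => E.
apply: (rdvd_theta (q := \prod_(k <- r | k != l) lin k)).
- exact: lin_prime.
- by move=> /rdvd_prod[k /andP[kr kl]]; exact: ndv.
- by rewrite E; exists 0; rewrite mul0r.
Qed.

Definition in_pencil w z l := exists a c, a != 0 /\ l = a *: w + c *: z.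

Lemma prod_pencil w z r : {in r, forall l, in_pencil w z l} ->
  exists A q, A != 0 /\
    \prod_(l <- r) lin l = A%:MP * lin w ^+ size r + lin z * q.
Proof.
elim: r => [|l r IH] hr.
  by exists 1, 0; rewrite oner_neq0 big_nil mpolyC1 expr0; split=> //; ring.
have [|A [q [A0 E]]] := IH; first by move=> k kr; apply: hr; rewrite inE kr orbT.
have [a [c [a0 ->]]] := hr l (mem_head _ _).
exists (a * A), (c%:MP * A%:MP * lin w ^+ size r + (a%:MP * lin w + c%:MP * lin z) * q).
split; first by rewrite mulf_neq0.
rewrite big_cons E linearD !linearZ /= -!mul_mpolyC mpolyCM exprS; ring.
Qed.

Lemma scaled_power_homog w (A : K) n : A%:MP * lin w ^+ n \is n.-homog.
Proof.
by rewrite mul_mpolyC; apply: dhomogZ; have := dhomogMn n (lin_homog w); rewrite mul1n.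
Qed.

(** Splitting off the power of w: q is the cofactor of z in a homogeneous
    difference, which fixes its degree. *)
Lemma prod_pencil_split w z r m : size r = m.+1 -> z != 0 ->
  {in r, forall l, in_pencil w z l} ->
  exists A q, [/\ A != 0,
    \prod_(l <- r) lin l = lin w * (A%:MP * lin w ^+ m) + lin z * q &
    q \is m.-homog].
Proof.
move=> sr z0 /prod_pencil[A [q [A0 E]]]; exists A, q.
have FE : \prod_(l <- r) lin l = lin w * (A%:MP * lin w ^+ m) + lin z * q.
  by rewrite E sr exprS; ring.
have Z0 : lin z != 0 by rewrite lin_eq0.
split=> //; apply: (homog_cofactor Z0 (lin_homog z)).
have -> : lin z * q = \prod_(l <- r) lin l - lin w * (A%:MP * lin w ^+ m).
  by rewrite FE; ring.
apply: rpredB; first by rewrite add1n -sr prod_lin_homog.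
exact: homogM (lin_homog w) (scaled_power_homog w A m) _.
Qed.

(** The Wronskian with z forgets the z-component of a line, so that tangency to
    all the lines of a pencil becomes divisibility of a single polynomial. *)
Lemma pencil_wronskian s w z a c :
  lin z * theta s (lin (a *: w + c *: z)) - lin (a *: w + c *: z) * theta s (lin z) =
  a%:MP * (lin z * theta s (lin w) - lin w * theta s (lin z)).
Proof. by rewrite theta_linD !theta_linZ linearD !linearZ /= -!mul_mpolyC; ring. Qed.

Lemma tangent_wronskian_rdvd s w z r : uniq r ->
  {in r &, forall k l, k != l -> ~ rdvd (lin l) (lin k)} ->
  {in r, forall l, in_pencil w z l} ->
  {in r, forall l, rdvd (lin l) (theta s (lin l))} ->
  rdvd (\prod_(l <- r) lin l) (lin z * theta s (lin w) - lin w * theta s (lin z)).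
Proof.
move=> ur np hr tg; apply: (prod_rdvd (l := @lin K 3)) => //.
- by move=> l _; exact: lin_prime.
- by move=> k l kr lr kl; apply: np => //; rewrite eq_sym.
move=> l lr; have := tg l lr; have [a [c [a0 ->]]] := hr l lr => tl.
rewrite -[X in rdvd _ X](mulKr (polyC_unit a0)) -(pencil_wronskian s w z a c).
apply: rdvd_mull; apply: rdvdB; first exact: rdvd_mull.
by apply: rdvd_mulr; exact: rdvdxx.
Qed.

Lemma wronskian_rdvd_tangent s w z r :
  {in r, forall l, in_pencil w z l} -> {in r, forall l, ~ rdvd (lin l) (lin z)} ->
  rdvd (\prod_(l <- r) lin l) (lin z * theta s (lin w) - lin w * theta s (lin z)) ->
  {in r, forall l, rdvd (lin l) (theta s (lin l))}.
Proof.
move=> hr nz [g Eg] l lr; apply: (lin_cancel (nz l lr)).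
have [a [c [a0 El]]] := hr l lr.
have -> : lin z * theta s (lin l) =
    a%:MP * (g * \prod_(l <- r) lin l) + theta s (lin z) * lin l.
  by rewrite -Eg -(pencil_wronskian s w z a c) -El; ring.
apply: rdvdD; apply: rdvd_mull; last exact: rdvdxx.
by apply: rdvd_mull; rewrite (big_rem l) //; apply: rdvd_mulr; exact: rdvdxx.
Qed.

End Products.

(** * The syzygies of two pencils and a generic line *)

Section Pencils.
Variables (K : fieldType) (p1 p2 x y z : 'rV[K]_3) (L1 L2 : seq 'rV[K]_3).
(* The degrees of P and Q, hence one less than the numbers of lines. *)
Variables (m1 m2 : nat).
Hypotheses (xp1 : dot x p1 = 0) (xp2 : dot x p2 != 0).
Hypotheses (yp1 : dot y p1 != 0) (yp2 : dot y p2 = 0).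
Hypotheses (zp1 : dot z p1 = 0) (zp2 : dot z p2 = 0) (z0 : z != 0).
Hypotheses (L1p1 : {in L1, forall l, dot l p1 = 0}).
Hypotheses (L1p2 : {in L1, forall l, dot l p2 != 0}).
Hypotheses (L2p1 : {in L2, forall l, dot l p1 != 0}).
Hypotheses (L2p2 : {in L2, forall l, dot l p2 = 0}).
Hypotheses (uL1 : uniq L1) (uL2 : uniq L2).
Hypotheses (L1_nprop : {in L1 &, forall k l, k != l -> ~ rdvd (lin l) (lin k)}).
Hypotheses (L2_nprop : {in L2 &, forall k l, k != l -> ~ rdvd (lin l) (lin k)}).
Hypotheses (sL1 : size L1 = m1.+1) (sL2 : size L2 = m2.+1).
Hypotheses (m1_gt0 : (0 < m1)%N) (m2_gt0 : (0 < m2)%N).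
Let h := x + y.
Hypothesis generic : {in L1 & L2, forall l k, ~ in_ideal2 (lin h) (lin k) (lin l)}.
Hypothesis charK : (m1 + m2).+3%:R != 0 :> K.

Local Notation S := {mpoly K[3]}.
Local Notation X := (lin x).
Local Notation Y := (lin y).
Local Notation Z := (lin z).
Let H : S := lin h.
Let F1 : S := \prod_(l <- L1) lin l.
Let F2 : S := \prod_(l <- L2) lin l.
Let f : S := H * (F1 * F2).

Let HE : H = X + Y. Proof. by rewrite /H linearD. Qed.

Let thetaH s : theta s H = theta s X + theta s Y.
Proof. exact: theta_linD. Qed.

Let M : 'M[K]_3 := \matrix_(i < 3) [:: x; y; z]`_i.

Let M_unit : M \in unitmx.
Proof.
rewrite -row_free_unit; apply: inj_row_free => c.
rewrite mulmx_sum_row !big_ord_recl big_ord0 addr0 !rowK /=.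
set c0 := c 0 _; set c1 := c 0 _; set c2 := c 0 _ => E.
have ev p : c0 * dot x p + (c1 * dot y p + c2 * dot z p) = 0.
  by rewrite -!dotZl -!dotDl E dot0l.
have c10 : c1 = 0.
  have /eqP := ev p1; rewrite xp1 zp1 !mulr0 add0r addr0.
  by rewrite mulf_eq0 (negPf yp1) orbF => /eqP.
have c00 : c0 = 0.
  have /eqP := ev p2; rewrite yp2 zp2 !mulr0 !addr0.
  by rewrite mulf_eq0 (negPf xp2) orbF => /eqP.
move/eqP: E; rewrite c10 c00 !scale0r !add0r scaler_eq0 (negPf z0) orbF => /eqP c20.
apply/rowP; case=> [[|[|[|//]]] Hi]; rewrite mxE;
  [rewrite -[RHS]c00|rewrite -[RHS]c10|rewrite -[RHS]c20]; congr (c _ _); exact: val_inj.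
Qed.

Let coords a b c : exists s,
  [/\ theta s X = a, theta s Y = b, theta s Z = c &
   forall k, a \is k.-homog -> b \is k.-homog -> c \is k.-homog -> homog_triple k s].
Proof.
have [s [sv sh]] := theta_coordinates (fun i : 'I_3 => [:: a; b; c]`_i) M_unit.
have s0 := sv (inord 0); have s1 := sv (inord 1); have s2 := sv (inord 2).
rewrite rowK inordK //= in s0; rewrite rowK inordK //= in s1; rewrite rowK inordK //= in s2.
exists s; split=> // k ha hb hc; apply: sh; by case=> [[|[|[|//]]] Hi].
Qed.

Let coords_inj s : theta s X = 0 -> theta s Y = 0 -> theta s Z = 0 -> s = 0.
Proof.
move=> sX sY sZ; apply: (theta_coordinates_inj M_unit) => i; rewrite rowK.
by case: i => [[|[|[|//]]] Hi].
Qed.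

Let decomp l : exists a b c, l = a *: x + b *: y + c *: z.
Proof.
have E := mulmxKV M_unit l; rewrite -E mulmx_sum_row !big_ord_recl big_ord0 addr0 !rowK /=.
by eexists _, _, _; rewrite addrA.
Qed.

Let decomp1 : {in L1, forall l, in_pencil x z l}.
Proof.
move=> l lL; have [a [b [c E]]] := decomp l.
have := L1p1 lL; rewrite E !dotDl !dotZl xp1 zp1 !mulr0 add0r addr0.
move/eqP; rewrite mulf_eq0 (negPf yp1) orbF => /eqP b0.
exists a, c; split; last by rewrite b0 scale0r addr0.
apply: contraNneq (L1p2 lL) => a0.
by rewrite E b0 a0 !scale0r !add0r dotZl zp2 mulr0.
Qed.

Let decomp2 : {in L2, forall l, in_pencil y z l}.
Proof.
move=> l lL; have [a [b [c E]]] := decomp l.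
have := L2p2 lL; rewrite E !dotDl !dotZl yp2 zp2 !mulr0 !addr0.
move/eqP; rewrite mulf_eq0 (negPf xp2) orbF => /eqP a0.
exists b, c; split; last by rewrite a0 scale0r add0r.
apply: contraNneq (L2p1 lL) => b0.
by rewrite E b0 a0 !scale0r !add0r dotZl zp1 mulr0.
Qed.

Let hp1 : dot h p1 != 0. Proof. by rewrite dotDl xp1 add0r. Qed.
Let hp2 : dot h p2 != 0. Proof. by rewrite dotDl yp2 addr0. Qed.

Let nZX : ~ rdvd Z X. Proof. exact: dot_nrdvd zp2 xp2. Qed.
Let nZY : ~ rdvd Z Y. Proof. exact: dot_nrdvd zp1 yp1. Qed.
Let nZH : ~ rdvd Z H. Proof. exact: dot_nrdvd zp1 hp1. Qed.
Let nHZ : ~ rdvd H Z. Proof. exact: dot_nrdvd_sym hp1 zp1 z0. Qed.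
Let nHF2 : ~ rdvd H F2.
Proof.
move=> /rdvd_prod[k]; rewrite andbT => kL; apply: dot_nrdvd_sym hp2 (L2p2 kL) _.
exact: dot_neq0 (L2p1 kL).
Qed.

Let nl1Z : {in L1, forall l, ~ rdvd (lin l) Z}.
Proof. by move=> l lL; apply: dot_nrdvd_sym (L1p2 lL) zp2 z0. Qed.
Let nl2Z : {in L2, forall l, ~ rdvd (lin l) Z}.
Proof. by move=> l lL; apply: dot_nrdvd_sym (L2p1 lL) zp1 z0. Qed.

Let lines := h :: L1 ++ L2.

Let lines_nprop : {in lines &, forall k l, k != l -> ~ rdvd (lin l) (lin k)}.
Proof.
move=> k l; rewrite !inE !mem_cat.
move=> /or3P[/eqP->|k1|k2] /or3P[/eqP->|l1|l2] kl.
- by rewrite eqxx in kl.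
- exact: dot_nrdvd (L1p1 l1) hp1.
- exact: dot_nrdvd (L2p2 l2) hp2.
- exact: dot_nrdvd_sym hp1 (L1p1 k1) (dot_neq0 (L1p2 k1)).
- exact: L1_nprop.
- exact: dot_nrdvd (L2p2 l2) (L1p2 k1).
- exact: dot_nrdvd_sym hp2 (L2p2 k2) (dot_neq0 (L2p1 k2)).
- exact: dot_nrdvd (L1p1 l1) (L2p1 k2).
- exact: L2_nprop.
Qed.

Let lines_uniq : uniq lines.
Proof.
rewrite /= cat_uniq uL1 uL2 mem_cat negb_or !andbT -andbA /=; apply/and3P; split.
- by apply: contraNN hp1 => /L1p1->.
- by apply: contraNN hp2 => /L2p2->.
- by apply/hasPn => l l2; apply: contraNN (L2p1 l2) => /L1p1->.
Qed.

Let f_prod : f = \prod_(l <- lines) lin l.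
Proof. by rewrite big_cons big_cat. Qed.

Let lin_neq0 (l : 'rV[K]_3) : l != 0 -> lin l != 0. Proof. by rewrite lin_eq0. Qed.
Let Z_neq0 : Z != 0. Proof. exact: lin_neq0. Qed.
Let H_neq0 : H != 0. Proof. exact: lin_neq0 (dot_neq0 hp2). Qed.
Let F1_neq0 : F1 != 0.
Proof.
by rewrite prodf_seq_neq0; apply/allP => l l1; exact: lin_neq0 (dot_neq0 (L1p2 l1)).
Qed.
Let F2_neq0 : F2 != 0.
Proof.
by rewrite prodf_seq_neq0; apply/allP => l l2; exact: lin_neq0 (dot_neq0 (L2p1 l2)).
Qed.
Let f_neq0 : f != 0. Proof. by rewrite !mulf_neq0. Qed.

Let F1_homog : F1 \is m1.+1.-homog. Proof. by rewrite -sL1 prod_lin_homog. Qed.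
Let F2_homog : F2 \is m2.+1.-homog. Proof. by rewrite -sL2 prod_lin_homog. Qed.
Let f_homog : f \is (m1 + m2).+3.-homog.
Proof.
rewrite f_prod; have := prod_lin_homog lines.
by rewrite /= size_cat sL1 sL2 addSn addnS.
Qed.

Let euler_f : theta (euler K) f = (m1 + m2).+3%:R * f.
Proof. by rewrite f_prod euler_prod_lin /= size_cat sL1 sL2 addSn addnS. Qed.

Section Split.
Variables (A B : K) (q1 q2 : S).
Hypotheses (A0 : A != 0) (B0 : B != 0).
Let P : S := A%:MP * X ^+ m1.
Let Q : S := B%:MP * Y ^+ m2.
Hypotheses (F1E : F1 = X * P + Z * q1) (F2E : F2 = Y * Q + Z * q2).
Hypotheses (q1_homog : q1 \is m1.-homog) (q2_homog : q2 \is m2.-homog).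

Let P_homog : P \is m1.-homog. Proof. exact: scaled_power_homog. Qed.
Let Q_homog : Q \is m2.-homog. Proof. exact: scaled_power_homog. Qed.

Let nZunit c : c \is a @GRing.unit S -> ~ rdvd Z c.
Proof.
by move=> cU d; apply: (@lin_rdvd1 _ _ z); rewrite -(mulVr cU); exact: rdvd_mull.
Qed.

Let nZQ : ~ rdvd Z Q.
Proof.
case/lin_prime; first exact/nZunit/polyC_unit.
apply: prime_eltX nZY _; [exact: lin_prime | exact: lin_rdvd1].
Qed.

Let nZYP : ~ in_ideal2 Z Y P.
Proof.
have n1 : ~ in_ideal2 Z Y 1 by move=> /in_ideal2_lin/lin_ideal_neq1.
have in_mull a b : in_ideal2 Z Y b -> in_ideal2 Z Y (a * b).
  by move=> [c [d ->]]; exists (a * c), (a * d); ring.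
case/lin2_prime => [AI|].
  by apply: n1; rewrite -(mulVr (polyC_unit A0)); exact: in_mull.
elim: (m1) => [|n IH]; first by rewrite expr0.
by rewrite exprS => /lin2_prime[|//]; exact: dot_nin_ideal2 zp2 yp2 xp2.
Qed.

(** The correspondence between fields s and pairs (u, v); it is additive in all
    three and insensitive to multiples of the Euler field. *)
Definition related s u v :=
  Z * theta s X - X * theta s Z = F1 * u /\ Z * theta s Y - Y * theta s Z = F2 * v.

(* Modulo z, both P u and Q v agree with - s(z). *)
Let syzygy_uv s : theta s f = 0 ->
  exists u v w, [/\ related s u v, rdvd H (F1 * u + F2 * v) & P * u - Q * v = Z * w].
Proof.
rewrite f_prod => /(theta_line lines_uniq lines_nprop) tg.
have tg1 : {in L1, forall l, rdvd (lin l) (theta s (lin l))}.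
  by move=> l lL; apply: tg; rewrite inE mem_cat lL orbT.
have tg2 : {in L2, forall l, rdvd (lin l) (theta s (lin l))}.
  by move=> l lL; apply: tg; rewrite inE mem_cat lL !orbT.
have dH : rdvd H (theta s H) by apply: tg; rewrite mem_head.
have [u Eu] := tangent_wronskian_rdvd uL1 L1_nprop decomp1 tg1.
have [v Ev] := tangent_wronskian_rdvd uL2 L2_nprop decomp2 tg2.
have rel : related s u v by split; rewrite ?Eu ?Ev mulrC.
have [Ru Rv] := rel.
have dP : rdvd Z (P * u + theta s Z).
  apply: (lin_cancel nZX).
  exists (theta s X - q1 * u).
  have -> : X * (P * u + theta s Z) = F1 * u + X * theta s Z - Z * q1 * u.
    by rewrite F1E; ring.
  by rewrite -Ru; ring.
have dQ : rdvd Z (Q * v + theta s Z).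
  apply: (lin_cancel nZY).
  exists (theta s Y - q2 * v).
  have -> : Y * (Q * v + theta s Z) = F2 * v + Y * theta s Z - Z * q2 * v.
    by rewrite F2E; ring.
  by rewrite -Rv; ring.
have [w Ew] := rdvdB dP dQ.
exists u, v, w; split=> //.
  have -> : F1 * u + F2 * v = Z * theta s H - theta s Z * H.
    by rewrite thetaH -Ru -Rv HE; ring.
  by apply: rdvdB; apply: rdvd_mull => //; exact: rdvdxx.
by rewrite [RHS]mulrC -Ew; ring.
Qed.

(* Once s(z) is taken to be - P u, the relation forces s(x) = q1 u and
   s(y) = q2 v - y w. This field is tangent to all the lines; the multiple of the
   Euler field that turns it into a syzygy exists because the degree of f is
   invertible. *)
Let uv_syzygy u v w : rdvd H (F1 * u + F2 * v) -> P * u - Q * v = Z * w ->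
  exists s, [/\ theta s f = 0, related s u v &
    forall k, q1 * u \is k.+1.-homog -> q2 * v - Y * w \is k.+1.-homog ->
      P * u \is k.+1.-homog -> homog_triple k.+1 s].
Proof.
move=> dH Ew; have [s [sX sY sZ sh]] := coords (q1 * u) (q2 * v - Y * w) (- (P * u)).
have Ru : Z * theta s X - X * theta s Z = F1 * u by rewrite sX sZ F1E; ring.
have Rv : Z * theta s Y - Y * theta s Z = F2 * v.
  rewrite sY sZ F2E.
  have -> : Z * (q2 * v - Y * w) = Z * q2 * v - Y * (Z * w) by ring.
  by rewrite -Ew; ring.
have df : rdvd f (theta s f).
  rewrite f_prod; apply: theta_prod_rdvd => l; rewrite inE mem_cat.
  case/or3P => [/eqP->|lL|lL].
  - apply: (lin_cancel nHZ).
    have -> : Z * theta s (lin h) = F1 * u + F2 * v + theta s Z * H.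
      by rewrite -/H thetaH -Ru -Rv HE; ring.
    by apply: rdvdD => //; apply: rdvd_mull; exact: rdvdxx.
  - apply: (wronskian_rdvd_tangent decomp1 nl1Z) lL.
    by exists u; rewrite Ru mulrC.
  - apply: (wronskian_rdvd_tangent decomp2 nl2Z) lL.
    by exists v; rewrite Rv mulrC.
have [g Eg] := df; pose d : K := (m1 + m2).+3%:R; pose e : S := d^-1%:MP * g.
have de : d%:MP * e = g by rewrite /e mulrA -mpolyCM mulfV ?charK // mul1r.
exists (s + (- e) *: euler K); split.
- rewrite thetaDl thetaZl euler_f Eg -de /d mpolyC_nat; ring.
- by split; rewrite !thetaDl !thetaZl !euler_lin -?Ru -?Rv; ring.
move=> k hX hY hZ; have s_homog : homog_triple k.+1 s by apply: sh; rewrite ?rpredN.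
have g_homog : g \is k.-homog.
  apply: (homog_cofactor f_neq0 f_homog); rewrite mulrC -Eg.
  apply: rpred_sum => i _; apply: (homogM (s_homog i) (e := (m1 + m2).+2)).
    exact: mderiv_homog.
  by rewrite addSnnS addnC.
move=> i; rewrite !mxE rpredD ?s_homog // mulNr rpredN.
apply: (homogM (d := k) (e := 1%N)); rewrite ?addn1 //.
  by rewrite /e mul_mpolyC; apply: dhomogZ.
by rewrite dhomogX; apply/eqP; exact: mdeg1.
Qed.

(* A field with vanishing u and v is a multiple of the Euler field, and the only
   such multiple that kills f is 0. *)
Let related_inj s : theta s f = 0 -> related s 0 0 -> s = 0.
Proof.
move=> sf [/eqP RX /eqP RY].
rewrite mulr0 subr_eq0 in RX; rewrite mulr0 subr_eq0 in RY.
move/eqP: RX => RX; move/eqP: RY => RY.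
have [e Ee] : rdvd Z (theta s Z).
  by apply: (lin_cancel nZX); exists (theta s X); rewrite -RX mulrC.
have EX : theta s X = e * X by apply: (mulfI Z_neq0); rewrite RX Ee; ring.
have EY : theta s Y = e * Y by apply: (mulfI Z_neq0); rewrite RY Ee; ring.
have Es : s + (- e) *: euler K = 0.
  by apply: coords_inj; rewrite thetaDl thetaZl euler_lin ?EX ?EY ?Ee; ring.
have Es' : s = e *: euler K.
  by rewrite -[s]addr0 -(subrr (e *: euler K)) addrCA -scaleNr Es addr0.
move/eqP: sf; rewrite Es' thetaZl euler_f mulrA mulf_eq0 (negPf f_neq0) orbF mulf_eq0.
rewrite -mpolyC_nat mpolyC_eq0 (negPf charK) orbF => /eqP->.
by rewrite scale0r.
Qed.

(* The last pair is (F2, -F1) corrected by a multiple of h so as to become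
   y (Q, P) modulo z. *)
Let gen_u (i : 'I_4) : S := [:: Z * H; 0; H * Q; F2]`_i.
Let gen_v (i : 'I_4) : S := [:: 0; Z * H; H * P; - F1 + H * P]`_i.

Let sum_gen (c : 'I_4 -> S) : exists c0 c1 c2 c3,
  [/\ c0 = c (inord 0), c1 = c (inord 1), c2 = c (inord 2), c3 = c (inord 3) &
  \sum_i c i * gen_u i = c0 * (Z * H) + c2 * (H * Q) + c3 * F2 /\
  \sum_i c i * gen_v i = c1 * (Z * H) + c2 * (H * P) + c3 * (- F1 + H * P)].
Proof.
do 4!eexists; split; try reflexivity.
have E (g : 'I_4 -> S) : \sum_i g i = g (inord 0) + g (inord 1) + g (inord 2) + g (inord 3).
  rewrite !big_ord_recl big_ord0 addr0 !addrA.
  by congr (g _ + g _ + g _ + g _); apply: val_inj; rewrite /= inordK.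
by rewrite !E /gen_u /gen_v !inordK //=; split; ring.
Qed.

(* [t] is the coefficient of (F2, -F1) modulo h, hence that of the fourth pair;
   [t'] is the coefficient of (Q, P) modulo z in what remains. *)
Let uv_span u v w : rdvd H (F1 * u + F2 * v) -> P * u - Q * v = Z * w ->
  exists c : 'I_4 -> S, u = \sum_i c i * gen_u i /\ v = \sum_i c i * gen_v i.
Proof.
move=> dH Ew.
have [||||t [[u' Eu] [v' Ev]]] := @syzygy_mod_prime S H F1 1 [seq lin l | l <- L2] u v.
- exact: lin_prime.
- exact: unitr1.
- move=> _ /mapP[l lL ->]; split; last 1 first.
  + by move=> /in_ideal2_prod[k kL]; exact: generic.
  + exact: dot_nrdvd_sym hp2 (L2p2 lL) (dot_neq0 (L2p1 lL)).
  + exact: lin2_prime.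
- by rewrite mul1r big_map.
rewrite mul1r big_map -/F2 in Eu.
pose v'' := v' - t * P.
have d' : rdvd Z (P * u' - Q * v'').
  apply: (lin_cancel nZH).
  exists (w - t * (P * q2 + Q * q1)).
  have -> : lin h * (P * u' - Q * v'') = P * (u' * H) - Q * (v' * H) + t * P * Q * H.
    by rewrite /v'' /H; ring.
  rewrite -Eu -Ev; have -> : (w - t * (P * q2 + Q * q1)) * Z = Z * w - Z * (t * (P * q2 + Q * q1)).
    by ring.
  by rewrite -Ew HE F1E F2E; ring.
have [||||t' [[a Ea] [b Eb]]] := @syzygy_mod_prime S Z P B%:MP (nseq m2 Y) u' (- v'').
- exact: lin_prime.
- exact: polyC_unit.
- move=> l /nseqP[-> _]; split=> //; exact: lin2_prime.
- rewrite big_nseq iter_mulr_1 -/Q; have -> : P * u' + Q * - v'' = P * u' - Q * v'' by ring.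
  exact: d'.
rewrite big_nseq iter_mulr_1 -/Q in Ea.
exists (fun i => [:: a; - b; t'; t]`_i).
have [c0 [c1 [c2 [c3 [-> -> -> -> [-> ->]]]]]] := sum_gen (fun i => [:: a; - b; t'; t]`_i).
rewrite !inordK //=; split.
  have -> : u = (u - t * F2) + t * F2 by ring.
  rewrite Eu; have -> : u' = (u' - t' * Q) + t' * Q by ring.
  by rewrite Ea; ring.
have -> : v = (v + t * F1) - t * F1 by ring.
rewrite Ev; have -> : v' = t' * P + t * P - (- v'' + t' * P) by rewrite /v''; ring.
by rewrite Eb; ring.
Qed.

(* Modulo h a relation gives h | c3, say c3 = r h, and then z | c2 + r y;
   this leaves c0 and c1 in the ideal generated by q1, q2, P and Q, which vanish
   at the origin since m1 and m2 are positive. *)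
Let uv_minimal (e : 'I_4 -> S) :
  \sum_i e i * gen_u i = 0 -> \sum_i e i * gen_v i = 0 -> forall i, (e i).@[fun=> 0] = 0.
Proof.
have [c0 [c1 [c2 [c3 [E0 E1 E2 E3 [-> ->]]]]]] := sum_gen e.
move=> Eu Ev.
have [r Er] : rdvd H c3.
  apply: (lin_cancel nHF2).
  exists (- (c0 * Z + c2 * Q)); rewrite -/H.
  have -> : F2 * c3 = c0 * (Z * H) + c2 * (H * Q) + c3 * F2 - (c0 * (Z * H) + c2 * (H * Q)) by ring.
  by rewrite Eu; ring.
have Eu' : c0 * Z + c2 * Q + r * F2 = 0.
  by apply: (mulfI H_neq0); rewrite mulr0 -Eu Er; ring.
have Ev' : c1 * Z + c2 * P + r * (- F1 + H * P) = 0.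
  by apply: (mulfI H_neq0); rewrite mulr0 -Ev Er; ring.
have [r' Er'] : rdvd Z (c2 + r * Y).
  apply: (lin_cancel nZQ).
  exists (- (c0 + r * q2)).
  have -> : Q * (c2 + r * Y) = c0 * Z + c2 * Q + r * (Y * Q + Z * q2) - Z * (c0 + r * q2) by ring.
  by rewrite -F2E Eu'; ring.
have Ec2 : c2 = r' * Z - r * Y by rewrite -Er'; ring.
have Ec0 : c0 = - (r * q2 + r' * Q).
  apply: (mulfI Z_neq0); apply/eqP; rewrite -subr_eq0; apply/eqP.
  by rewrite -Eu' F2E Ec2; ring.
have Ec1 : c1 = r * q1 - r' * P.
  apply: (mulfI Z_neq0); apply/eqP; rewrite -subr_eq0; apply/eqP.
  by rewrite -Ev' F1E HE Ec2; ring.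
have q1z := homog_meval0 m1_gt0 q1_homog; have q2z := homog_meval0 m2_gt0 q2_homog.
have Pz := homog_meval0 m1_gt0 P_homog; have Qz := homog_meval0 m2_gt0 Q_homog.
have e0 : (e (inord 0)).@[fun=> 0] = 0.
  by rewrite -E0 Ec0 mevalN mevalD mevalM q2z [X in _ + X]mevalM Qz; ring.
have e1 : (e (inord 1)).@[fun=> 0] = 0.
  by rewrite -E1 Ec1 mevalB mevalM q1z [X in _ - X]mevalM Pz; ring.
have e2 : (e (inord 2)).@[fun=> 0] = 0.
  by rewrite -E2 Ec2 mevalB !mevalM !lin_meval0; ring.
have e3 : (e (inord 3)).@[fun=> 0] = 0.
  by rewrite -E3 Er mevalM lin_meval0 mulr0.
move=> i; rewrite -(inord_val i); case: i => [[|[|[|[|//]]]] Hi] //=.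
Qed.

Let exps := [:: m1.+2; m2.+2; (m1 + m2).+1; (m1 + m2).+1].

Let generators (i : 'I_4) : exists s,
  [/\ theta s f = 0, related s (gen_u i) (gen_v i) & homog_triple (nth 0%N exps i) s].
Proof.
have lh := @lin_homog K 3.
have gen u v w k : rdvd H (F1 * u + F2 * v) -> P * u - Q * v = Z * w ->
    q1 * u \is k.+1.-homog -> q2 * v - Y * w \is k.+1.-homog ->
    P * u \is k.+1.-homog ->
    exists s, [/\ theta s f = 0, related s u v & homog_triple k.+1 s].
  move=> dH Ew h1 h2 h3; have [s [s1 s2 s3]] := uv_syzygy dH Ew.
  by exists s; split=> //; exact: s3.
have ZH2 : Z * H \is 2.-homog by apply: homogM (lh _) (lh _) _.
have HQ : H * Q \is m2.+1.-homog by apply: homogM (lh _) Q_homog _.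
have HP : H * P \is m1.+1.-homog by apply: homogM (lh _) P_homog _.
(* The explicit polynomial given to [gen] is the quotient of P u - Q v by z. *)
case: i => [[|[|[|[|//]]]] Hi]; rewrite /gen_u /gen_v /=.
- apply: (gen _ _ (P * H)).
  + by exists (F1 * Z); ring.
  + ring.
  + by apply: homogM q1_homog ZH2 _; rewrite addn2.
  + rewrite mulr0 sub0r rpredN.
    by apply: homogM (lh _) (homogM P_homog (lh _) (erefl _)) _; rewrite addn1 add1n.
  + by apply: homogM P_homog ZH2 _; rewrite addn2.
- apply: (gen _ _ (- (Q * H))).
  + by exists (F2 * Z); ring.
  + ring.
  + by rewrite mulr0 dhomog0.
  + rewrite mulrN opprK rpredD //; first by apply: homogM q2_homog ZH2 _; rewrite addn2.
    by apply: homogM (lh _) (homogM Q_homog (lh _) (erefl _)) _; rewrite addn1 add1n.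
  + by rewrite mulr0 dhomog0.
- apply: (gen _ _ 0).
  + by exists (F1 * Q + F2 * P); ring.
  + ring.
  + by apply: homogM q1_homog HQ _; rewrite addnS.
  + by rewrite mulr0 subr0; apply: homogM q2_homog HP _; rewrite addnS addnC.
  + by apply: homogM P_homog HQ _; rewrite addnS.
- apply: (gen _ _ (P * q2 + Q * q1)).
  + by exists (F2 * P); ring.
  + by rewrite HE F1E F2E; ring.
  + by apply: homogM q1_homog F2_homog _; rewrite addnS.
  + rewrite rpredB //.
      apply: (homogM q2_homog (e := m1.+1)); last by rewrite addnS addnC.
      by rewrite rpredD // rpredN.
    apply: (homogM (lh y) (e := (m1 + m2)%N)); last by rewrite add1n.
    by rewrite rpredD //; [apply: homogM P_homog q2_homog _ | apply: homogM Q_homog q1_homog _; rewrite addnC].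
  + by apply: homogM P_homog F2_homog _; rewrite addnS.
Qed.

Let related_sum (g : 'I_4 -> 'rV[S]_3) (c : 'I_4 -> S) (J : {set 'I_4}) :
  (forall i, related (g i) (gen_u i) (gen_v i)) ->
  related (\sum_(i in J) c i *: g i)
    (\sum_(i in J) c i * gen_u i) (\sum_(i in J) c i * gen_v i).
Proof.
move=> rg; split; rewrite !theta_suml !mulr_sumr -sumrB; apply: eq_bigr => i _;
  have [R1 R2] := rg i.
  have -> : F1 * (c i * gen_u i) = c i * (F1 * gen_u i) by ring.
  by rewrite -R1; ring.
have -> : F2 * (c i * gen_v i) = c i * (F2 * gen_v i) by ring.
by rewrite -R2; ring.
Qed.

Let related_unique s u v u' v' : related s u v -> related s u' v' -> u = u' /\ v = v'.
Proof.
move=> [R1 R2] [R1' R2']; split; [apply: (mulfI F1_neq0) | apply: (mulfI F2_neq0)].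
  by rewrite -R1 R1'.
by rewrite -R2 R2'.
Qed.

Lemma split_exponents : (m1 <= m2)%N -> has_exponents f exps.
Proof.
move=> m12; split.
  by rewrite /= !ltnS m12 leqnn -[in X in (X <= _)%N](add1n m2) leq_add2r m1_gt0.
have [g gP] := fin_all_exists generators.
have gf i : theta (g i) f = 0 by case: (gP i).
have gr i : related (g i) (gen_u i) (gen_v i) by case: (gP i).
exists g; split; last by move=> i; case: (gP i).
have gens : generates_syzygies f g [set: 'I_4].
  move=> s; split=> [sf|[c ->]]; last first.
    by rewrite /jacobian_syzygy -/(theta _ _) theta_suml big1 // => i _; rewrite gf mulr0.
  have [u [v [w [[R1 R2] dH Ew]]]] := syzygy_uv sf.
  have [c [Eu Ev]] := uv_span dH Ew; exists c.
  have [T1 T2] := related_sum c [set: 'I_4] gr.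
  have EJ (V : nmodType) (F : 'I_4 -> V) : \sum_(i in [set: 'I_4]) F i = \sum_i F i.
    by apply: eq_bigl => i; rewrite inE.
  set t := \sum_(i in _) _ *: _ in T1 T2 *.
  have tf : theta t f = 0 by rewrite theta_suml big1 // => i _; rewrite gf mulr0.
  rewrite !EJ -Eu -Ev in T1 T2.
  suff E : s + (-1) *: t = 0 by rewrite -[s]addr0 -(subrr t) addrCA -scaleN1r E addr0.
  apply: related_inj; first by rewrite thetaDl thetaZl (sf : theta s f = 0) tf mulr0 addr0.
  split; rewrite !thetaDl !thetaZl.
    have -> : Z * (theta s X + -1 * theta t X) - X * (theta s Z + -1 * theta t Z) =
      (Z * theta s X - X * theta s Z) - (Z * theta t X - X * theta t Z) by ring.
    by rewrite R1 T1; ring.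
  have -> : Z * (theta s Y + -1 * theta t Y) - Y * (theta s Z + -1 * theta t Z) =
    (Z * theta s Y - Y * theta s Z) - (Z * theta t Y - Y * theta t Z) by ring.
  by rewrite R2 T2; ring.
split=> // J gJ; apply/setP => i; rewrite inE; apply/negPn/negP => iJ.
have [c Ec] := (gJ (g i)).1 (gf i).
have rJ := related_sum c J gr; rewrite -Ec in rJ.
have [Eu Ev] := related_unique (gr i) rJ.
(* The relation that expresses the generator [i] has coefficient 1 at [i]. *)
pose e j := (j == i)%:R - (if j \in J then c j else 0).
have sum_e (F : 'I_4 -> S) : F i = \sum_(j in J) c j * F j -> \sum_j e j * F j = 0.
  move=> EF; under eq_bigr do rewrite /e mulrBl.
  rewrite sumrB (bigD1 i) //= eqxx mul1r big1 ?addr0 => [|j ji]; last by rewrite (negPf ji) mul0r.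
  rewrite EF [X in X - _]big_mkcond; apply/eqP; rewrite subr_eq0; apply/eqP.
  by apply: eq_bigr => j _; case: ifP => //; rewrite mul0r.
have := uv_minimal (sum_e _ Eu) (sum_e _ Ev) i.
by rewrite /e eqxx (negPf iJ) subr0 meval1 => /eqP; rewrite oner_eq0.
Qed.

End Split.

Lemma pencils_exponents : (m1 <= m2)%N ->
  has_exponents f [:: m1.+2; m2.+2; (m1 + m2).+1; (m1 + m2).+1].
Proof.
have [A [q1 [A0 E1 h1]]] := prod_pencil_split sL1 z0 decomp1.
have [B [q2 [B0 E2 h2]]] := prod_pencil_split sL2 z0 decomp2.
exact: split_exponents E1 E2 h1 h2.
Qed.

Lemma pencils_msize : msize f = (m1 + m2).+4.
Proof.
have := dhomog_msize f_homog; move/(dhomog_uniq f_neq0 f_homog) => E.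
have : (0 < msize f)%N by rewrite lt0n msize_poly_eq0.
by case: (msize f) E => [|n] //= <-.
Qed.

End Pencils.

(** * Points and lines of the projective plane *)

Section PlaneVectors.
Variable K : fieldType.
Implicit Types l m p q v w : 'rV[K]_3.

Lemma dotE l p : dot l p = (l *m p^T) 0 0.
Proof. by rewrite mxE; apply: eq_bigr => i _; rewrite mxE. Qed.

Lemma dotC l p : dot l p = dot p l.
Proof. by apply: eq_bigr => i _; rewrite mulrC. Qed.

Lemma exists_common_zero l m : exists v, [/\ v != 0, dot l v = 0 & dot m v = 0].
Proof.
pose N := kermx (col_mx l m)^T; pose v := nz_row N.
have v0 : v != 0.
  rewrite nz_row_eq0 -mxrank_eq0 -lt0n mxrank_ker mxrank_tr subn_gt0.
  exact: leq_ltn_trans (rank_leq_row _) _.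
have /sub_kermxP : (v <= N)%MS by exact: nz_row_sub.
rewrite tr_col_mx mul_mx_row -[0]row_mx0 => /eq_row_mx[vl vm].
by exists v; rewrite v0 !(dotC _ v) !dotE vl vm mxE.
Qed.

Lemma mxrank_col2 l m : l != 0 -> ~~ (m <= l)%MS -> \rank (col_mx l m) = 2%N.
Proof.
move=> l0 ml; apply/eqP; rewrite eqn_leq rank_leq_row /= -addsmxE.
have : (l < l + m)%MS by rewrite ltmxE addsmxSl addsmx_sub submx_refl.
by move/rank_ltmx; rewrite rank_rV l0.
Qed.

Lemma common_zero_unique l m p q : l != 0 -> ~~ (m <= l)%MS -> p != 0 ->
  dot l p = 0 -> dot m p = 0 -> dot l q = 0 -> dot m q = 0 -> (q <= p)%MS.
Proof.
move=> l0 ml p0 lp mp lq mq; apply/negPn/negP => qp.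
suff E : col_mx l m *m (col_mx p q)^T = 0.
  by have := mulmx0_rank_max E; rewrite mxrank_tr !mxrank_col2.
have z u v : dot u v = 0 -> u *m v^T = 0.
  by rewrite dotE => E; apply/matrixP => i j; rewrite !ord1 E mxE.
by rewrite tr_col_mx mul_col_row !z // block_mx_const.
Qed.

Lemma exists_independent_zeros l : exists v w,
  [/\ v != 0, ~~ (w <= v)%MS, dot l v = 0 & dot l w = 0].
Proof.
have [v [v0 lv _]] := exists_common_zero l l.
have rk : (1 < \rank (kermx l^T))%N.
  by rewrite mxrank_ker mxrank_tr; have := rank_leq_row l; case: (\rank l) => [|[|]].
have /row_subPn[i wi] : ~~ (kermx l^T <= v)%MS.
  by apply: contraL rk => /mxrankS; rewrite rank_rV v0 -leqNgt.
exists v, (row i (kermx l^T)); split=> //.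
by rewrite dotC dotE -row_mul mulmx_ker row0 mxE.
Qed.

End PlaneVectors.

Section Plane.
Variable R : realType.
Implicit Types (p q L : proj_plane R) (A P : {fset proj_plane R}).

Lemma hcoord_neq0 p : hcoord p != 0.
Proof. by rewrite vpick0 -dimv_eq0 (eqP (valP p)). Qed.

Lemma hcoord_span p : val p = <[hcoord p]>%VS.
Proof.
apply/eqP; rewrite eq_sym eqEdim -memvE memv_pick dim_vline hcoord_neq0.
by rewrite (eqP (valP p)).
Qed.

Lemma hcoord_prop p q : (hcoord p <= hcoord q)%MS -> p = q.
Proof.
case/sub_rVP => a E; apply: val_inj; rewrite !hcoord_span.
apply/eqP; rewrite eqEdim !dim_vline !hcoord_neq0 andbT -memvE E.
exact: memvZ (memv_line _).
Qed.

Fact span_point_subproof (v : 'rV[R[i]]_3) : v != 0 -> \dim <[v]>%VS == 1%N.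
Proof. by move=> v0; rewrite dim_vline v0. Qed.

Definition span_point v (v0 : v != 0) : proj_plane R :=
  exist _ <[v]>%VS (span_point_subproof v0).

Lemma hcoord_span_point v (v0 : v != 0) : exists a, hcoord (span_point v0) = a *: v.
Proof. by apply/vlineP; exact: memv_pick. Qed.

Lemma on_lineE p L : on_line p L = (dot (hcoord L) (hcoord p) == 0).
Proof. by []. Qed.

Lemma exists_meet L L' : exists p, on_line p L && on_line p L'.
Proof.
have [v [v0 l l']] := exists_common_zero (hcoord L) (hcoord L').
exists (span_point v0); have [a E] := hcoord_span_point v0.
by rewrite !on_lineE E ![dot _ (a *: v)]dotC !dotZl ![dot v _]dotC l l' mulr0 eqxx.
Qed.

Definition meet L L' := xchoose (exists_meet L L').

Lemma meet_on L L' : on_line (meet L L') L && on_line (meet L L') L'.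
Proof. exact: xchooseP (exists_meet L L'). Qed.

Lemma meet_unique p L L' : L != L' -> on_line p L -> on_line p L' -> p = meet L L'.
Proof.
move=> LL' /eqP pL /eqP pL'; have /andP[/eqP mL /eqP mL'] := meet_on L L'.
apply: hcoord_prop; apply: common_zero_unique mL mL' pL pL'; rewrite ?hcoord_neq0 //.
by apply: contra_neqN LL' => /hcoord_prop.
Qed.

(** If v and w span the zeros of the line, the points v + t w with t a natural
    number are distinct. *)
Lemma line_infinite L n : exists s : seq (proj_plane R),
  [/\ uniq s, size s = n & forall p, p \in s -> on_line p L].
Proof.
have [v [w [v0 wv lv lw]]] := exists_independent_zeros (hcoord L).
have vw t : v + t%:R *: w != 0.
  have [->|t0] := eqVneq t 0%N; first by rewrite scale0r addr0.
  apply: contraNneq wv => E; apply/sub_rVP; exists (- t%:R^-1).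
  have tR : t%:R != 0 :> R[i] by rewrite pnatr_eq0.
  have -> : v = - (t%:R *: w) by apply/eqP; rewrite -addr_eq0 E.
  by rewrite scalerN scaleNr opprK scalerA mulVf // scale1r.
pose pt t := span_point (vw t); exists [seq pt t | t <- iota 0 n].
split; rewrite ?size_map ?size_iota //; last first.
  move=> _ /mapP[t _ ->]; have [a E] := hcoord_span_point (vw t).
  by rewrite on_lineE E dotC dotZl dotDl dotZl !(dotC _ (hcoord L)) lv lw !mulr0 addr0 mulr0.
rewrite map_inj_uniq ?iota_uniq // => t1 t2 /(congr1 val) /= E.
have /vlineP[a] : v + t1%:R *: w \in <[v + t2%:R *: w]>%VS by rewrite -E memv_line.
rewrite scalerDr scalerA => Ea.
have Eb : (1 - a) *: v = (a * t2%:R - t1%:R) *: w.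
  have Ev : v = a *: v + (a * t2%:R) *: w - t1%:R *: w by rewrite -Ea addrK.
  by rewrite !scalerBl scale1r {1}Ev [LHS]addrAC [X in X - _]addrAC subrr add0r.
have at2 : a * t2%:R = t1%:R.
  apply/eqP; rewrite -subr_eq0; apply: contraNT wv => b0; apply/sub_rVP.
  exists ((a * t2%:R - t1%:R)^-1 * (1 - a)).
  by rewrite -scalerA Eb scalerA mulVf // scale1r.
move/eqP: Eb; rewrite at2 subrr scale0r scaler_eq0 (negPf v0) orbF subr_eq0 => /eqP a1.
by move/eqP: at2; rewrite -a1 mul1r eqr_nat => /eqP.
Qed.

(** * Generic lines *)

Section Generic.
Variables (A : {fset proj_plane R}) (H : proj_plane R).
Hypothesis genA : generic_line A H.

(** Otherwise the intersection would be the whole line, which is infinite. *)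
Lemma generic_notin : H \notin A.
Proof.
have [P [cardP PE]] := genA; apply/negP => HA.
have [s [us ss sH]] := line_infinite H (#|` A|).+1.
suff : (size s <= size (enum_fset P))%N by rewrite ss -cardP ltnn.
apply: uniq_leq_size us _ => p ps.
suff : p \in P by [].
by rewrite PE sH //=; apply/hasP; exists H => //; exact: sH.
Qed.

(** The |A| points of the intersection lie in the image of A under L |-> L . H,
    which therefore has at least |A| elements. *)
Lemma generic_meet_inj : {in A &, injective (meet^~ H)}.
Proof.
have [P [cardP PE]] := genA.
apply/card_in_imfsetP; rewrite eqn_leq leq_imfset_card /= -cardP.
apply: fsubset_leq_card; apply/fsubsetP => p; rewrite PE => /andP[pH /hasP[L LA pL]].
apply/imfsetP; exists L => //=; apply: meet_unique => //.
by apply: contraNneq generic_notin => <-.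
Qed.

Lemma generic_not_concurrent p L L' : L \in A -> L' \in A ->
  on_line p H -> on_line p L -> on_line p L' -> L = L'.
Proof.
move=> LA LA' pH pL pL'; apply: generic_meet_inj => //.
have nH k : k \in A -> k != H by move=> kA; apply: contraNneq generic_notin => <-.
by rewrite -!(@meet_unique p) // nH.
Qed.

End Generic.
End Plane.

(** * Arrangements as products of linear forms *)

Section Arrangement.
Variable R : realType.
Implicit Types (A B : {fset line R}) (L H : line R).

Lemma hcoord_inj : injective (@hcoord R).
Proof. by move=> p q E; apply: hcoord_prop; rewrite E. Qed.

Definition forms A : seq 'rV[R[i]]_3 := [seq hcoord L | L <- enum_fset A].

Lemma forms_uniq A : uniq (forms A).
Proof. by rewrite map_inj_uniq ?fset_uniq //; exact: hcoord_inj. Qed.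

Lemma size_forms A : size (forms A) = #|` A|.
Proof. by rewrite size_map. Qed.

Lemma mem_forms A l : l \in forms A -> exists2 L, L \in A & l = hcoord L.
Proof. by case/mapP => L; exists L. Qed.

Lemma forms_nprop A :
  {in forms A &, forall k l, k != l -> ~ rdvd (lin l) (lin k)}.
Proof.
move=> _ _ /mem_forms[L _ ->] /mem_forms[L' _ ->] /eqP ne /lin_rdvd/hcoord_prop E.
by apply: ne; rewrite E.
Qed.

Lemma arrangement_eqU A B H : [disjoint A & B]%fset -> H \notin (A `|` B)%fset ->
  arrangement_eq (H |` (A `|` B))%fset =
  lin (hcoord H) * (\prod_(l <- forms A) lin l * \prod_(l <- forms B) lin l).
Proof.
move=> dAB HAB; rewrite /arrangement_eq big_fsetU1 //=; congr (_ * _).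
rewrite !big_map -big_cat; apply: perm_big; apply: uniq_perm.
- exact: fset_uniq.
- rewrite cat_uniq !fset_uniq andbT /=; apply/hasPn => L LB /=.
  apply/negP => LA; move/fdisjointP/(_ L LA): dAB; by rewrite LB.
by move=> L; rewrite mem_cat in_fsetU.
Qed.

Lemma exists_two A : (1 < #|` A|)%N -> exists L L', [/\ L \in A, L' \in A & L != L'].
Proof.
rewrite -[#|` A|]/(size (enum_fset A)); have := fset_uniq A.
have mem L : L \in enum_fset A -> L \in A by [].
case E: (enum_fset A) => [|L [|L' s]] //=; rewrite inE negb_or => /andP[/andP[ne _] _] _.
by exists L, L'; split=> //; apply: mem; rewrite E !inE eqxx ?orbT.
Qed.

End Arrangement.

Lemma type2_arith m1 m2 :
  (m1.+2)%:Z + (m2.+2)%:Z + 1 - ((m1 + m2).+3)%:Z = 2 :> int.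
Proof. lia. Qed.

Theorem corollary1p19 (R : realType) (n1 n2 : nat) (a1 a2 : point R)
    (B1 B2 : {fset line R}) (H : line R)
    (hn1 : (3 <= n1)%N) (hn12 : (n1 <= n2)%N)
    (cardB1 : #|` B1|%fset = n1) (cardB2 : #|` B2|%fset = n2)
    (hB1 : forall L : line R, L \in B1 -> on_line a1 L)
    (hB2 : forall L : line R, L \in B2 -> on_line a2 L)
    (ha2 : forall L : line R, L \in B1 -> ~~ on_line a2 L)
    (ha1 : forall L : line R, L \in B2 -> ~~ on_line a1 L)
    (hH : generic_line (B1 `|` B2)%fset H) :
  let f := arrangement_eq (H |` (B1 `|` B2))%fset in
  is_type2B f /\
  has_exponents f
    [:: (n1 + 1)%N; (n2 + 1)%N; (n1 + n2 - 1)%N; (n1 + n2 - 1)%N].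
Proof.
move=> f.
have sub1 L : L \in B1 -> L \in (B1 `|` B2)%fset by move=> LB; rewrite in_fsetU LB.
have sub2 L : L \in B2 -> L \in (B1 `|` B2)%fset by move=> LB; rewrite in_fsetU LB orbT.
have two1 : (1 < #|` B1|)%N by rewrite cardB1; apply: leq_trans hn1.
have two2 : (1 < #|` B2|)%N by rewrite cardB2; apply: leq_trans hn12; apply: leq_trans hn1.
have dB : [disjoint B1 & B2]%fset.
  apply/fdisjointP => L L1; apply/negP => L2.
  by have := ha1 _ L2; rewrite hB1.
pose h := hcoord H; pose p1 := hcoord a1; pose p2 := hcoord a2.
have hp1 : dot h p1 != 0.
  apply/negP => a1H; have [L [L' [L1 L1' ne]]] := exists_two two1.
  move/eqP: ne; apply; apply: (generic_not_concurrent hH) a1H _ _; auto.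
have hp2 : dot h p2 != 0.
  apply/negP => a2H; have [L [L' [L1 L1' ne]]] := exists_two two2.
  move/eqP: ne; apply; apply: (generic_not_concurrent hH) a2H _ _; auto.
have L1p1 : {in forms B1, forall l, dot l p1 = 0}.
  by move=> _ /mem_forms[L LB ->]; apply/eqP; exact: hB1.
have L1p2 : {in forms B1, forall l, dot l p2 != 0}.
  by move=> _ /mem_forms[L LB ->]; exact: ha2.
have L2p1 : {in forms B2, forall l, dot l p1 != 0}.
  by move=> _ /mem_forms[L LB ->]; exact: ha1.
have L2p2 : {in forms B2, forall l, dot l p2 = 0}.
  by move=> _ /mem_forms[L LB ->]; apply/eqP; exact: hB2.
have [L [L' [LB L'B ne]]] := exists_two two1.
have l'l : ~ (hcoord L' <= hcoord L)%MS by move/hcoord_prop => E; rewrite E eqxx in ne.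
have dL1 J : J \in B1 -> dot (hcoord J) p1 = 0 by move=> JB; apply/eqP; exact: hB1.
have [x [y [z [[hE xp1 xp2 yp1 yp2] [zp1 zp2 z0]]]]] :=
  exists_pencil_coordinates (dL1 _ LB) (dL1 _ L'B) (ha2 _ LB) l'l hp1 hp2.
(* The point where [J'] meets [H] would lie on [J] as well. *)
have generic : {in forms B1 & forms B2, forall l k,
    ~ in_ideal2 (lin (x + y)) (lin k) (lin l)}.
  move=> _ _ /mem_forms[J JB ->] /mem_forms[J' JB' ->].
  rewrite -hE => /lin_in_ideal2P[a [b E]].
  have /andP[mJ' mH] := meet_on J' H.
  have mJ : on_line (meet J' H) J.
    rewrite on_lineE E dotDl !dotZl.
    by rewrite /h (eqP (mJ' : dot _ _ == 0)) (eqP (mH : dot _ _ == 0)) !mulr0 addr0.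
  have JJ' : J = J' by apply: (generic_not_concurrent hH) mH mJ mJ'; auto.
  by have := ha1 _ JB'; rewrite -JJ' hB1.
have [m1 E1 m1_gt0] : exists2 m1, n1 = m1.+1 & (0 < m1)%N.
  by exists n1.-1; case: (n1) hn1 => [|[]].
have [m2 E2 m2_gt0] : exists2 m2, n2 = m2.+1 & (0 < m2)%N.
  by exists n2.-1; case: (n2) (leq_trans hn1 hn12) => [|[]].
have s1 : size (forms B1) = m1.+1 by rewrite size_forms cardB1.
have s2 : size (forms B2) = m2.+1 by rewrite size_forms cardB2.
have charR : (m1 + m2).+3%:R != 0 :> R[i] by rewrite pnatr_eq0.
have fE : f = lin (x + y) * (\prod_(l <- forms B1) lin l * \prod_(l <- forms B2) lin l).
  by rewrite -hE; apply: arrangement_eqU => //; exact: (generic_notin hH).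
have ex : has_exponents f [:: (n1 + 1)%N; (n2 + 1)%N; (n1 + n2 - 1)%N; (n1 + n2 - 1)%N].
  have -> : [:: (n1 + 1)%N; (n2 + 1)%N; (n1 + n2 - 1)%N; (n1 + n2 - 1)%N] =
     [:: m1.+2; m2.+2; (m1 + m2).+1; (m1 + m2).+1].
    by rewrite E1 E2 !addn1 addSn addnS subn1.
  rewrite fE; apply: (pencils_exponents (p1 := p1) (p2 := p2) (z := z)) => //.
  - exact: forms_uniq.
  - exact: forms_uniq.
  - exact: forms_nprop.
  - exact: forms_nprop.
  - by rewrite -ltnS -E1 -E2.
split=> //; eexists; split; first exact: ex; last by [].
have fsize : msize f = (m1 + m2).+4.
  by rewrite fE; apply: (pencils_msize (p1 := p1) (p2 := p2)).
by rewrite /type_of_exponents fsize E1 E2 !addn1; exact: type2_arith.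
Qed.
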